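(* Let $\kappa$ be an infinite cardinal. Then $X={}^{<<\kappa}\square\,2^\kappa$ is $\mathrm{cf}(\kappa)$-metrisable and hence b-ultraparacompact.
   Context: $2=\{0,1\}$ is discrete. The bounded box topology ${}^{<<\kappa}\square\,2^\kappa$ is the set of functions $\kappa\to2$ with the topology whose canonical base consists of the clopen sets $[s]=\{f:s\subseteq f\}$ for partial functions $s:\kappa\to2$ whose domain is a bounded subset of $\kappa$. For a cardinal $\theta$, a space $X$ with open sets $\tau(X)$ is $\theta$-metrisable if there is $U:X\times\theta\to\tau(X)$ such that each $\{U(x,i):i<\theta\}$ is a neighbourhood base at $x$, and for all $x,y$ and $i\le j<\theta$: if $y\in U(x,i)$ then $U(y,j)\subseteq U(x,i)$; if $y\notin U(x,i)$ then $U(y,j)\cap U(x,i)=\emptyset$. The space is b-ultraparacompact if every open cover has a refinement (a cover each of whose members is contained in a member of the given cover) consisting of pairwise disjoint sets from the canonical base. *)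

(* Defs.v *)
From HB Require Import structures.
From mathcomp Require Import all_boot all_order.
From mathcomp Require Import all_classical topology.

Set Implicit Arguments.
Unset Strict Implicit.
Unset Printing Implicit Defensive.
Import Order.TTheory.

Local Open Scope classical_set_scope.
Local Open Scope card_scope.
Local Open Scope order_scope.

(* Ordinals are represented by well-founded total orders, an element a of such
   an order standing for the ordinal of [set x | x < a].  A cardinal is an
   initial ordinal: it does not inject into any of its proper initial
   segments. *)
Definition is_cardinal d (T : orderType d) : Prop :=
  well_founded (fun x y : T => x < y) /\
  forall a : T, ~ ([set: T] #<= [set x | x < a]).

Record infinite_cardinal d := InfiniteCardinal {
  card_order :> orderType d;
  card_cardinal : is_cardinal card_order;
  card_infinite : infinite_set [set: card_order]
}.

Definition bounded_subset d (T : orderType d) (A : set T) : Prop :=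
  exists a, A `<=` [set x | x < a].

(* T has order type cf(K), the least ordinal having a map with unbounded range
   into K; cofinality_exists and cofinality_cardinal below show that such a T
   exists and is a cardinal. *)
Definition is_cofinality d' (T : orderType d') d (K : orderType d) : Prop :=
  [/\ well_founded (fun s t : T => s < t),
      exists f : T -> K, ~ bounded_subset (range f)
    & forall (t : T) (f : T -> K), bounded_subset (f @` [set s | s < t])].

Section BoundedBox.
Context d (K : infinite_cardinal d).

Definition bounded_box : Type := K -> bool.

HB.instance Definition _ := gen_eqMixin bounded_box.
HB.instance Definition _ := gen_choiceMixin bounded_box.

(* A partial function s : K -> 2 is a total function into option bool, with
   s x = None when x is outside the domain of s. *)
Definition pdom (s : K -> option bool) : set K := [set x | s x <> None].

Definition cylinder (s : K -> option bool) : set bounded_box :=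
  [set f | forall x b, s x = Some b -> f x = b].

Definition canonical_base : set (set bounded_box) :=
  [set cylinder s | s in [set s | bounded_subset (pdom s)]].

Lemma canonical_base_cover : \bigcup_(B in canonical_base) B = setT.
Proof.
have [a _] := infinite_setN0 (@card_infinite _ K).
apply/seteqP; split=> // f _.
exists (cylinder (fun=> None)) => //.
by exists (fun=> None) => //; exists a.
Qed.

Lemma canonical_base_join (A B : set bounded_box) (f : bounded_box) :
  canonical_base A -> canonical_base B -> A f -> B f ->
  exists C, [/\ canonical_base C, C f & C `<=` A `&` B].
Proof.
move=> [s [a sa] <-] [t [b tb] <-] sf tf.
exists (cylinder (fun x => if s x is Some c then Some c else t x)); split.
- exists (fun x => if s x is Some c then Some c else t x) => //.
  exists (Order.max a b) => x; rewrite /pdom/= lt_max.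
  case E : (s x) => [c|] h; first by rewrite sa// /pdom/= E.
  by rewrite [x < b]tb ?orbT.
- by move=> x c; case E : (s x) => [e|]; [move=> [<-]; exact: sf|exact: tf].
- move=> g gst; split=> x c E; apply: gst; rewrite ?E//.
  case E' : (s x) => [e|//].
  by rewrite -(sf _ _ E') (tf _ _ E).
Qed.

HB.instance Definition _ := isBaseTopological.Build bounded_box
  canonical_base_cover canonical_base_join.

End BoundedBox.

(* theta-metrisability, where theta is the order type of T. *)
Definition metrisable_at d (T : orderType d) (X : topologicalType) : Prop :=
  exists U : X -> T -> set X,
    [/\ forall x i, open (U x i),
        forall x, nbhs x = filter_from setT (U x)
      & forall (x y : X) (i j : T), i <= j ->
          (U x i y -> U y j `<=` U x i) /\
          (~ U x i y -> U y j `&` U x i = set0)].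

Definition set_cover (X : Type) (C : set (set X)) : Prop :=
  \bigcup_(A in C) A = setT.

Definition refines (X : Type) (R C : set (set X)) : Prop :=
  set_cover R /\ forall B, R B -> exists2 A, C A & B `<=` A.

Definition b_ultraparacompact (X : topologicalType) (base : set (set X)) : Prop :=
  forall C : set (set X), C `<=` open -> set_cover C ->
    exists R : set (set X), [/\ refines R C, R `<=` base & trivIset R id].

Section Segment.
Context d (K : orderType d) (a : K).
Definition segment : Type := {x : K | x < a}.
HB.instance Definition _ := SubChoice.on segment.
HB.instance Definition _ := [SubChoice_isSubOrder of segment by <: with d].
End Segment.

Lemma cofinality_exists d (K : infinite_cardinal d) :
  exists (d' : Order.disp_t) (T : orderType d'), is_cofinality T K.
Proof.
have wfK : well_founded (fun x y : K => x < y) by case: (card_cardinal K).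
have KnB : ~ bounded_subset [set: K].
  by move=> [a] /(_ a I)/=; rewrite ltxx.
pose Q (b : K) := exists f : K -> K, ~ bounded_subset (f @` [set y | y < b]).
have [[b Qb]|nQ] := pselect (exists b, Q b); last first.
  exists d, (K : orderType d); split => //.
    by exists id; rewrite image_id.
  by move=> t f; apply: contra_notP nQ => ?; exists t, f.
have [m [[f fm] mmin]] : exists m, Q m /\ forall c, c < m -> ~ Q c.
  elim/(well_founded_ind wfK): b Qb => b IH Qb.
  have [[c [cb Qc]]|h] := pselect (exists c, c < b /\ Q c); first exact: IH cb Qc.
  by exists b; split=> // c cb Qc; apply: h; exists c.
pose T : orderType d := segment (m : K).
exists d, T; split.
- have acc (x : K) : forall xm : x < m,
      Acc (fun s t : T => s < t) (exist (fun x => x < m) x xm).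
    elim/(well_founded_ind wfK): x => x IH xm.
    by constructor=> -[y ym] yx; apply: IH.
  by move=> [x xm]; exact: acc.
- exists (f \o val); apply: contra_not fm => -[a ha]; exists a => _ [y ym <-].
  by apply: ha; exists (exist (fun x => x < m) y ym).
- move=> t g; apply: contrapT => gt.
  apply: (mmin (val t) (valP t)).
  have [t0 _] := infinite_setN0 (@card_infinite _ K).
  exists (fun x => if insub x is Some s then g (s : T) else t0).
  apply: contra_not gt => -[a ha]; exists a => _ [s st <-].
  by apply: ha; exists (val s) => //; rewrite valK.
Qed.

Lemma cofinality_cardinal d' (T : orderType d') d (K : infinite_cardinal d) :
  is_cofinality T K -> is_cardinal T.
Proof.
move=> [wfT [f fT] fB]; split=> // a /card_leP [g].
have [k _] := infinite_setN0 (@card_infinite _ K).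
pose h (t : T) : T := val (g (SigSub (mem_set (I : [set: T] t)))).
have hi : injective h.
  by move=> x y /val_inj /(@inj _ _ _ g); rewrite !inE => /(_ I I) [].
apply: fT.
have [c hc] := fB a (fun s => if pselect (exists t, h t = s) is left e
                              then f (sval (cid e)) else k).
exists c => _ [t _ <-]; apply: hc.
exists (h t); first exact: set_valP.
case: pselect => [e|]; last by case; exists t.
by congr f; case: (cid e) => /= u /hi.
Qed.

(* Main.v *)
(** Let [f] be a map with unbounded range from [T], of order type cf(K), into
   [K], and let [U x i] consist of the functions agreeing with [x] on the
   union of the segments below [f s], for [s <= i].  Agreement on a set is an
   equivalence relation, which becomes finer as [i] increases, and this makes
   the [U x i] witness metrisability.  Given an open cover, choose for each [x]
   the least [i] with [U x i] contained in a member of the cover: minimality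
   forces any two of the chosen sets to be equal or disjoint. *)

Require Import Defs.
From mathcomp Require Import all_boot all_order.
From mathcomp Require Import all_classical topology.

Set Implicit Arguments.
Unset Strict Implicit.
Unset Printing Implicit Defensive.
Import Order.TTheory.

Local Open Scope classical_set_scope.
Local Open Scope order_scope.

Lemma well_founded_minimum d (T : orderType d) (P : set T) :
  well_founded (fun s t : T => s < t) -> P !=set0 ->
  exists2 m, P m & forall t, P t -> m <= t.
Proof.
move=> wfT [t]; elim/(well_founded_ind wfT): t => t IH Pt.
have [[s [st Ps]]|h] := pselect (exists s, s < t /\ P s); first exact: IH st Ps.
by exists t => // s Ps; rewrite leNgt; apply/negP => st; apply: h; exists s.
Qed.

(** The condition inside [metrisable_at] with its witness [U] exposed, so that the same [U] can also
    be required to consist of canonical basic sets. *)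
Definition metrisable_by d (T : orderType d) (X : topologicalType)
    (U : X -> T -> set X) : Prop :=
  [/\ forall x i, open (U x i),
      forall x, nbhs x = filter_from setT (U x)
    & forall (x y : X) (i j : T), i <= j ->
        (U x i y -> U y j `<=` U x i) /\
        (~ U x i y -> U y j `&` U x i = set0)].

Lemma metrisable_by_mem d (T : orderType d) (X : topologicalType)
    (U : X -> T -> set X) x i : metrisable_by U -> U x i x.
Proof.
by move=> [_ nbhsU _]; apply: nbhs_singleton; rewrite nbhsU; exists i.
Qed.

Lemma metrisable_by_ultraparacompact d (T : orderType d) (X : topologicalType)
    (U : X -> T -> set X) (base : set (set X)) :
  well_founded (fun s t : T => s < t) -> metrisable_by U ->
  (forall x i, base (U x i)) -> b_ultraparacompact base.
Proof.
move=> wfT mU baseU C Copen Ccover; have [_ nbhsU sepU] := mU.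
pose small x i := exists2 A, C A & U x i `<=` A.
have /choice[m mP] x : exists i, small x i /\ forall j, small x j -> i <= j.
  have [|i] := @well_founded_minimum _ _ (small x) wfT; last by exists i.
  have [A CA Ax] : (\bigcup_(A in C) A) x by rewrite Ccover.
  have : nbhs x A by apply: open_nbhs_nbhs; split=> //; exact: Copen.
  by rewrite nbhsU => -[i _ UA]; exists i, A.
(* If the chosen sets of [x] and [y] meet and [m x <= m y], separation puts [y] in [U x (m x)]. *)
have sub x y z : U x (m x) z -> U y (m y) z -> m x <= m y ->
    U x (m x) = U y (m y).
  move=> Uxz Uyz mxy.
  have Uxy : U x (m x) y.
    apply: contrapT => /(sepU _ _ _ _ mxy).2 /seteqP[+ _].
    by apply; split; [exact: Uyz|].
  (* [U y (m x)] lies in [U x (m x)], hence in a member of the cover, so [m x] competes with the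
     least index [m y]. *)
  have mE : m x = m y.
    apply/eqP; rewrite eq_le mxy /=; apply: (mP y).2.
    have [[A CA UA] _] := mP x; exists A => //.
    exact: subset_trans ((sepU _ _ _ _ (lexx _)).1 Uxy) UA.
  have Uyx : U y (m x) x.
    apply: contrapT => /(sepU _ _ _ _ (lexx _)).2 /seteqP[+ _].
    by apply; split; [exact: Uxz|rewrite mE].
  rewrite -mE; apply/seteqP; split.
    exact: (sepU _ _ _ _ (lexx _)).1 Uyx.
  exact: (sepU _ _ _ _ (lexx _)).1 Uxy.
exists (range (fun x => U x (m x))); split.
- split=> [|_ [x _ <-]]; last by have [[A CA UA] _] := mP x; exists A.
  apply/seteqP; split=> // x _.
  by exists (U x (m x)); [exists x|exact: metrisable_by_mem].
- by move=> _ [x _ <-].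
- move=> _ _ [x _ <-] [y _ <-] [z [Uxz Uyz]].
  have [mxy|myx] := leP (m x) (m y); first exact: sub Uxz Uyz mxy.
  by apply/esym; exact: sub Uyz Uxz (ltW myx).
Qed.

Section BoxBalls.
Context d (K : infinite_cardinal d) d' (T : orderType d') (f : T -> K).

Lemma canonical_base_open (B : set (bounded_box K)) :
  canonical_base B -> open B.
Proof.
move=> bB; exists [set B]; first by move=> _ ->.
by rewrite bigcup_set1.
Qed.

Lemma open_canonical_base (A : set (bounded_box K)) x :
  open A -> A x -> exists B, [/\ canonical_base B, B x & B `<=` A].
Proof.
move=> [D Dbase <-] [B DB Bx]; exists B; split=> //; first exact: Dbase.
by move=> y By; exists B.
Qed.

(** As [f] may fail to be monotone, the segments below all [f s] with [s <= i] are united, which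
    makes the domains increase with [i]. *)
Definition box_dom (i : T) : set K :=
  [set k | exists2 s, s <= i & k < f s].

Definition box_ball (x : bounded_box K) (i : T) : set (bounded_box K) :=
  [set y | {in box_dom i, x =1 y}].

Lemma box_dom_le i j : i <= j -> box_dom i `<=` box_dom j.
Proof. by move=> ij k [s si kfs]; exists s => //; exact: le_trans ij. Qed.

Lemma bounded_box_dom i : bounded_subset (f @` [set s | s < i]) ->
  bounded_subset (box_dom i).
Proof.
(* The bound [a] covers only the [f s] with [s < i]; the maximum accounts for [s = i]. *)
move=> [a fa]; exists (Order.max a (f i)) => k [s si kfs] /=.
rewrite lt_max; move: si; rewrite le_eqVlt => /predU1P[<-|si].
  by rewrite kfs orbT.
by rewrite (lt_trans kfs)//; apply: fa; exists s.
Qed.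

(** Let [a] bound [A]. As the range of [f] is unbounded, some [f i] is at least [a], and the segment
    below it already contains [A]. *)
Lemma bounded_sub_box_dom (A : set K) : ~ bounded_subset (range f) ->
  bounded_subset A -> exists i, A `<=` box_dom i.
Proof.
move=> fT [a Aa]; apply: contrapT => noi; apply: fT; exists a => _ [i _ <-] /=.
rewrite ltNge; apply/negP => afi; apply: noi; exists i => k Ak.
by exists i => //; exact: lt_le_trans (Aa k Ak) afi.
Qed.

Lemma box_ball_base x i : bounded_subset (box_dom i) ->
  canonical_base (box_ball x i).
Proof.
move=> [a ia].
exists (fun k => if k \in box_dom i then Some (x k) else None).
  by exists a => k; rewrite /pdom/=; case: ifPn => // /set_mem/ia.
apply/seteqP; split=> y /= xy k.
  by move=> ki; apply/esym/xy; rewrite ki.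
by move=> b; case: ifPn => // ki [<-]; rewrite xy.
Qed.

Lemma metrisable_by_box_ball : ~ bounded_subset (range f) ->
  (forall i, bounded_subset (box_dom i)) -> metrisable_by box_ball.
Proof.
move=> fT domB.
have ballO x i : open (box_ball x i).
  exact/canonical_base_open/box_ball_base/domB.
split=> //.
- move=> x; apply/seteqP; split=> A.
    rewrite nbhsE => -[O [Oo Ox] OA].
    have [_ [[s sB <-] sx sO]] := open_canonical_base Oo Ox.
    have [i si] := bounded_sub_box_dom fT sB.
    exists i => // y xy; apply/OA/sO => k b skb.
    rewrite -xy; first exact: sx.
    by apply/mem_set/si; rewrite /pdom/= skb.
  by move=> [i _ xA]; rewrite nbhsE; exists (box_ball x i).
- move=> x y i j ij.
  have sub k : k \in box_dom i -> k \in box_dom j.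
    by move=> /set_mem ki; apply/mem_set; exact: box_dom_le ki.
  split=> [xy z yz k ki|nxy]; first by rewrite xy// yz// sub.
  (* A common point [z] agrees with both [x] and [y] on [box_dom i], so [y] would lie in the ball of
     [x]. *)
  rewrite -subset0 => z [yz xz]; apply: nxy => k ki.
  by rewrite xz// yz// sub.
Qed.

End BoxBalls.

Lemma is_cofinality_box_ball d (K : infinite_cardinal d) d' (T : orderType d') :
  is_cofinality T K -> exists U : bounded_box K -> T -> set (bounded_box K),
    metrisable_by U /\ forall x i, canonical_base (U x i).
Proof.
move=> [_ [f fT] fB]; exists (box_ball f).
have domB i : bounded_subset (box_dom f i) by exact/bounded_box_dom/fB.
by split; [exact: metrisable_by_box_ball|move=> x i; exact: box_ball_base].
Qed.

Theorem theorem7p13 (d : Order.disp_t) (K : infinite_cardinal d) :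
  (forall (d' : Order.disp_t) (T : orderType d'),
     is_cofinality T K -> metrisable_at T (bounded_box K)) /\
  b_ultraparacompact (canonical_base (K := K)).
Proof.
split=> [d' T /is_cofinality_box_ball[U [mU _]]|]; first by exists U.
(* Ultraparacompactness mentions no index order, so one of order type cf(K) is supplied here. *)
have [d' [T cfT]] := cofinality_exists K.
have [U [mU baseU]] := is_cofinality_box_ball cfT.
by have [wfT _ _] := cfT; exact: metrisable_by_ultraparacompact wfT mU baseU.
Qed.
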